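(* Assume $(\Gamma,\Omega,\Delta)=(\Gamma',\Omega',\Delta')$ (as sets of declarations). If $\Gamma;\Omega;\Delta\vdash M:A$ and $\Gamma';\Omega';\Delta'\vdash M:A'$, then $A=A'$.
   Context: Strict $\lambda$-calculus over a fixed signature $\Sigma$ declaring atomic types and constants $c{:}A$, each at most once. Labels $k\in\{1,0,u\}$; types $A::=a\mid A_1\to^kA_2$; terms $c\mid x\mid\lambda x^k{:}A.M\mid M_1M_2^k$. Contexts: finite sets of declarations $x{:}A$ with distinct variables; $(\Gamma_1,\Gamma_2)$ denotes union with disjoint domains. Typing $\Gamma;\Omega;\Delta\vdash M:A$ ($\Gamma$ unrestricted, $\Omega$ irrelevant, $\Delta$ strict; pairwise disjoint domains): if $c{:}A\in\Sigma$ then $\Gamma;\Omega;\cdot\vdash c:A$; $(\Gamma,x{:}A);\Omega;\cdot\vdash x:A$; $\Gamma;\Omega;x{:}A\vdash x:A$ (no rule for variables of $\Omega$); from $(\Gamma,x{:}A);\Omega;\Delta\vdash M:B$ infer $\Gamma;\Omega;\Delta\vdash\lambda x^u{:}A.M:A\to^uB$; from $\Gamma;(\Omega,x{:}A);\Delta\vdash M:B$ infer $\Gamma;\Omega;\Delta\vdash\lambda x^0{:}A.M:A\to^0B$; from $\Gamma;\Omega;(\Delta,x{:}A)\vdash M:B$ infer $\Gamma;\Omega;\Delta\vdash\lambda x^1{:}A.M:A\to^1B$; from $\Gamma;\Omega;\Delta\vdash M:A\to^uB$ and $(\Gamma,\Delta);\Omega;\cdot\vdash N:A$ infer $\Gamma;\Omega;\Delta\vdash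 MN^u:B$; from $\Gamma;\Omega;\Delta\vdash M:A\to^0B$ and $(\Gamma,\Omega,\Delta);\cdot;\cdot\vdash N:A$ infer $\Gamma;\Omega;\Delta\vdash MN^0:B$; from $(\Gamma,\Delta_N);\Omega;\Delta_M\vdash M:A\to^1B$ and $(\Gamma,\Delta_M);\Omega;\Delta_N\vdash N:A$ infer $\Gamma;\Omega;(\Delta_M,\Delta_N)\vdash MN^1:B$. *)

(* Defs.v *)
From mathcomp Require Export all_boot finmap.
Set Implicit Arguments.
Unset Strict Implicit.
Unset Printing Implicit Defensive.

Open Scope fset_scope.
Open Scope fmap_scope.

(* Variables are natural numbers; names of bound variables are explicit and
   terms are identified up to [alpha] below. *)
Notation var := nat (only parsing).

Inductive label := L1 | L0 | Lu.

Inductive ty (atom : Type) :=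
  | TAtom of atom
  | TArr of label & ty atom & ty atom.

(* [atype] is the type of the declared atomic types. A partial function
   expresses that each constant is declared at most once. *)
Record signature := Signature {
  atype : Type;
  const : Type;
  sdecl : const -> option (ty atype)
}.

Section Calculus.
Variable Sig : signature.

Definition stype := ty (atype Sig).

Inductive term :=
  | Con of const Sig
  | Var of var
  | Lam of label & var & stype & term
  | App of label & term & term.

Fixpoint fv (M : term) : {fset var} :=
  match M with
  | Con _ => fset0
  | Var x => [fset x]
  | Lam _ x _ M => fv M `\ x
  | App _ M N => fv M `|` fv N
  end.

Definition swapv (x y z : var) : var :=
  if z == x then y else if z == y then x else z.

(* Exchanges [x] and [y] everywhere, including in binding positions. *)
Fixpoint swap (x y : var) (M : term) : term :=
  match M with
  | Con c => Con c
  | Var z => Var (swapv x y z)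
  | Lam k z A M => Lam k (swapv x y z) A (swap x y M)
  | App k M N => App k (swap x y M) (swap x y N)
  end.

Inductive alpha : term -> term -> Prop :=
  | alpha_rename k x y A M : y \notin fv M ->
      alpha (Lam k x A M) (Lam k y A (swap x y M))
  | alpha_lam k x A M M' : alpha M M' -> alpha (Lam k x A M) (Lam k x A M')
  | alpha_app k M M' N N' :
      alpha M M' -> alpha N N' -> alpha (App k M N) (App k M' N')
  | alpha_refl M : alpha M M
  | alpha_sym M N : alpha M N -> alpha N M
  | alpha_trans M N P : alpha M N -> alpha N P -> alpha M P.

(* A finite set of declarations with distinct variables is a finite map.
   [G + D] (right-biased) is only used on disjoint domains, and [G.[x <- A]]
   only for [x] not in the domain of [G]; then both denote unions. *)
Definition ctx := {fmap var -> stype}.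

Definition disj (G D : ctx) : bool := [disjoint domf G & domf D]%fset.

Definition zones (G Om D : ctx) : bool := [&& disj G Om, disj G D & disj Om D].

Inductive typing : ctx -> ctx -> ctx -> term -> stype -> Prop :=
  | ty_const G Om c A :
      zones G Om [fmap] -> sdecl c = Some A ->
      typing G Om [fmap] (Con c) A
  | ty_varu G Om x A :
      x \notin domf G -> zones G.[x <- A] Om [fmap] ->
      typing G.[x <- A] Om [fmap] (Var x) A
  | ty_var1 G Om x A :
      zones G Om [fmap].[x <- A] ->
      typing G Om [fmap].[x <- A] (Var x) A
  | ty_lamu G Om D x A M B :
      x \notin domf G `|` domf Om `|` domf D ->
      typing G.[x <- A] Om D M B ->
      typing G Om D (Lam Lu x A M) (TArr Lu A B)
  | ty_lam0 G Om D x A M B :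
      x \notin domf G `|` domf Om `|` domf D ->
      typing G Om.[x <- A] D M B ->
      typing G Om D (Lam L0 x A M) (TArr L0 A B)
  | ty_lam1 G Om D x A M B :
      x \notin domf G `|` domf Om `|` domf D ->
      typing G Om D.[x <- A] M B ->
      typing G Om D (Lam L1 x A M) (TArr L1 A B)
  | ty_appu G Om D M N A B :
      typing G Om D M (TArr Lu A B) ->
      typing (G + D) Om [fmap] N A ->
      typing G Om D (App Lu M N) B
  | ty_app0 G Om D M N A B :
      typing G Om D M (TArr L0 A B) ->
      typing (G + Om + D) [fmap] [fmap] N A ->
      typing G Om D (App L0 M N) B
  | ty_app1 G Om DM DN M N A B :
      disj DM DN -> zones G Om (DM + DN) ->
      typing (G + DN) Om DM M (TArr L1 A B) ->
      typing (G + DM) Om DN N A ->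
      typing G Om (DM + DN) (App L1 M N) B
  (* identification of terms up to renaming of bound variables *)
  | ty_alpha G Om D M M' A :
      typing G Om D M A -> alpha M M' -> typing G Om D M' A.

Lemma disj_setl (G D : ctx) x A : disj G.[x <- A] D -> disj G D.
Proof.
apply: fdisjointWl; apply/fsubsetP => y yG.
by rewrite dom_setf in_fset1U yG orbT.
Qed.

Lemma disj_setr (G D : ctx) x A : disj G D.[x <- A] -> disj G D.
Proof.
by rewrite /disj fdisjoint_sym => /disj_setl; rewrite /disj fdisjoint_sym.
Qed.

Lemma typing_zones G Om D M A : typing G Om D M A -> zones G Om D.
Proof.
elim=> {G Om D M A} //.
- move=> G Om D x A M B _ _ /and3P[h1 h2 h3]; apply/and3P; split.
  + exact: (disj_setl h1).
  + exact: (disj_setl h2).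
  + exact: h3.
- move=> G Om D x A M B _ _ /and3P[h1 h2 h3]; apply/and3P; split.
  + exact: (disj_setr h1).
  + exact: h2.
  + exact: (disj_setl h3).
- move=> G Om D x A M B _ _ /and3P[h1 h2 h3]; apply/and3P; split.
  + exact: h1.
  + exact: (disj_setr h2).
  + exact: (disj_setr h3).
Qed.

End Calculus.

Arguments Con {Sig} c.
Arguments Var {Sig} x.
Arguments Lam {Sig} k x A M.
Arguments App {Sig} k M N.

(* Main.v *)
Require Import Defs.

(** Only the union of the three zones matters for the type of a term: erasing
    the zones leaves ordinary Church-style typing, in which the type is computed
    from the term. The computation ignores the arguments of applications and is
    invariant under renaming of bound variables, so it agrees with every
    derivation, whatever its uses of the renaming rule. *)

Section Inference.
Variable Sig : signature.
Implicit Types (e : nat -> option (stype Sig)) (M N : term Sig) (A B : stype Sig).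
Implicit Types G Om D : ctx Sig.

(** Environments are functions rather than finite maps, so that a swap of variables acts on them by
    precomposition. *)
Definition extend e (x : nat) A : nat -> option (stype Sig) :=
  fun z => if z == x then Some A else e z.

Definition codomain A : option (stype Sig) :=
  if A is TArr _ _ B then Some B else None.

Fixpoint infer e M : option (stype Sig) :=
  match M with
  | Con c => sdecl c
  | Var x => e x
  | Lam k x A M => omap (TArr k A) (infer (extend e x A) M)
  | App _ M _ => obind codomain (infer e M)
  end.

Lemma eq_infer_fv M e e' : {in fv M, e =1 e'} -> infer e M = infer e' M.
Proof.
elim: M e e' => [c|x|k x A M IH|k M IHM N _] e e' //= ee'.
- by apply: ee'; rewrite inE.
- congr omap; apply: IH => z zM; rewrite /extend; case: eqP => // /eqP zx.
  by apply: ee'; rewrite !inE zx.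
- by congr obind; apply: IHM => z zM; apply: ee'; rewrite inE zM.
Qed.

Lemma eq_infer M e e' : e =1 e' -> infer e M = infer e' M.
Proof. by move=> ee'; apply: eq_infer_fv => z _. Qed.

Lemma swapvK x y : involutive (swapv x y).
Proof.
move=> z; rewrite /swapv; case: (eqVneq z x) => [->|zx].
  by rewrite eqxx; case: eqP.
by case: (eqVneq z y) => [->|zy]; rewrite ?eqxx // (negPf zx) (negPf zy).
Qed.

(** Since [swapv x y] is a bijection, extending at a swapped binder and then precomposing with the
    swap amounts to precomposing first and extending at the original binder. *)
Lemma infer_swap x y M e : infer e (swap x y M) = infer (e \o swapv x y) M.
Proof.
elim: M e => [c|z|k z A M IH|k M IHM N _] e //=; last by rewrite IHM.
rewrite IH; congr omap; apply: eq_infer => w.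
by rewrite /extend /= (inj_eq (inv_inj (swapvK x y))).
Qed.

Lemma infer_alpha M M' : alpha M M' -> infer^~ M =1 infer^~ M'.
Proof.
elim=> {M M'} [k x y A M yM|k x A M M' _ IH|k M M' N N' _ IHM _ _|M|M N _ IH|
  M N P _ IH1 _ IH2] e //=.
(* After the swap the two environments can differ only at [y], which is not free in the body. *)
- congr omap; rewrite infer_swap; apply: eq_infer_fv => z zM.
  rewrite /extend /= /swapv; case: (eqVneq z x) => [_|zx]; first by rewrite eqxx.
  have zy : z != y by apply: contraNneq yM => <-.
  by rewrite !(negPf zy).
- by rewrite IH.
- by rewrite IHM.
- by rewrite IH1 IH2.
Qed.

Lemma infer_lam G k x A M :
  infer (fnd G) (Lam k x A M) = omap (TArr k A) (infer (fnd G.[x <- A]) M).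
Proof. by congr omap; apply: eq_infer => z; rewrite /extend fnd_set. Qed.

(** Concatenation is right-biased: an update of the left map survives only where the right map is
    undefined, whereas one of the right map always does. *)
Lemma set_catf_l G D x A : x \notin domf D -> (G + D).[x <- A] = G.[x <- A] + D.
Proof.
move=> xD; apply/fmapP => z; rewrite !(fnd_set, fnd_cat).
by case: (eqVneq z x) => [->|//]; rewrite (negPf xD).
Qed.

Lemma set_catf_r G D x A : (G + D).[x <- A] = G + D.[x <- A].
Proof.
apply/fmapP => z; rewrite !(fnd_set, fnd_cat) dom_setf !inE.
by case: (eqVneq z x).
Qed.

(** By induction on the derivation. For an application only the function premise matters, and its
    zones have the same union as those of the conclusion. *)
Lemma infer_typing G Om D M A :
  typing G Om D M A -> infer (fnd (G + Om + D)) M = Some A.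
Proof.
elim=> {G Om D M A}.
- by [].
(* Disjointness of the zones keeps [Om] from overriding the declaration of [x]. *)
- move=> G Om x A _ /and3P[/fdisjointP GOm _ _]; rewrite catf0 -set_catf_l.
    by rewrite /= fnd_set eqxx.
  by apply: GOm; rewrite dom_setf fset1U1.
- by move=> G Om x A _; rewrite -set_catf_r /= fnd_set eqxx.
- move=> G Om D x A M B; rewrite !inE !negb_or => /andP[/andP[_ xOm] xD] _ IH.
  by rewrite infer_lam !set_catf_l // IH.
- move=> G Om D x A M B; rewrite !inE !negb_or => /andP[_ xD] _ IH.
  by rewrite infer_lam set_catf_l // set_catf_r IH.
- by move=> G Om D x A M B _ _ IH; rewrite infer_lam set_catf_r IH.
- move=> G Om D M N A B _ IH _ _; exact: (congr1 (obind codomain) IH).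
- move=> G Om D M N A B _ IH _ _; exact: (congr1 (obind codomain) IH).
- move=> G Om DM DN M N A B disjD _ /typing_zones/and3P[disjGOm _ _] IH _ _.
  (* The function premise keeps [DN] in its unrestricted zone, to the left of [Om] and [DM]. As [DN]
     is disjoint from [DM] by the rule and from [Om] by the zones of that premise, moving it past
     them changes no lookup. *)
  suff -> : G + Om + (DM + DN) = G + DN + Om + DM.
    exact: (congr1 (obind codomain) IH).
  apply/fmapP => z; rewrite !fnd_cat mem_catf.
  have zDM : z \in DN -> (z \in DM) = false.
    by apply: contraTF; move/fdisjointP: disjD; apply.
  have zOm : z \in DN -> (z \in Om) = false.
    move=> zDN; apply/negbTE; move/fdisjointP: disjGOm; apply.
    by rewrite mem_catf zDN orbT.
  case: (boolP (z \in DN)) => zDN; last by rewrite orbF.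
  by rewrite orbT zDM // zOm.
- by move=> G Om D M M' A _ IH /infer_alpha <-.
Qed.

End Inference.

Theorem theorem3p1 (Sig : signature) (G Om D G' Om' D' : ctx Sig) (M : term Sig)
    (A A' : stype Sig) :
  G + Om + D = G' + Om' + D' ->
  typing G Om D M A -> typing G' Om' D' M A' -> A = A'.
Proof.
by move=> eqG /infer_typing + /infer_typing; rewrite eqG => -> [].
Qed.
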